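(* Let $N\ge 1$ be an integer, and suppose that $f(z)=\sum_{k=0}^\infty a_k z^k$ is analytic in $\mathbb{D}$ and $|f(z)|<1$ in $\mathbb{D}$. Then, with $|z|=r$, $$|f(z)|+\sum_{k=N}^\infty |a_k|r^k\le 1\quad\text{for } r\le R_N,$$ where $R_N$ is the positive root of the equation $\psi_N(r)=0$, $\psi_N(r)=2(1+r)r^N-(1-r)^2$. The radius $R_N$ is best possible (it cannot be replaced by any larger number such that the inequality still holds for all such $f$). Moreover, $$|f(z)|^2+\sum_{k=N}^\infty |a_k|r^k\le 1\quad\text{for } r\le R_N',$$ where $R_N'$ is the positive root of the equation $(1+r)r^N-(1-r)^2=0$. The radius $R_N'$ is best possible (in the same sense).
   Context: $\mathbb{D}=\{z\in\mathbb{C}:|z|<1\}$ is the open unit disk. Throughout, $r=|z|$ with $z\in\mathbb{D}$, and the inequalities are asserted for every $z$ with $|z|=r$ in the indicated range. *)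

(* Defs.v *)
From Stdlib Require Export Reals.
From Coquelicot Require Export Coquelicot.
Open Scope R_scope.

(* [f] is a total function on [C]; only its values on the open unit disk are
   constrained.  [ex_derive] is taken over the field [C_AbsRing], so it is
   complex differentiability. *)
Definition bounded_analytic_disk (f : C -> C) (a : nat -> C) : Prop :=
  (forall z : C, Cmod z < 1 -> @ex_derive C_AbsRing C_NormedModule f z) /\
  (forall z : C, Cmod z < 1 -> @is_pseries C_AbsRing C_NormedModule a z (f z)) /\
  (forall z : C, Cmod z < 1 -> Cmod (f z) < 1).

Definition tail_term (a : nat -> C) (N : nat) (r : R) (k : nat) : R :=
  Cmod (a (N + k)%nat) * r ^ (N + k).

(* [Series] is a total operator, meaningful only when the series converges;
   convergence for r < 1 has to be established separately. *)
Definition tail_sum (a : nat -> C) (N : nat) (r : R) : R :=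
  Series (tail_term a N r).

Definition bohr_ineq (p N : nat) (f : C -> C) (a : nat -> C) (z : C) : Prop :=
  Cmod (f z) ^ p + tail_sum a N (Cmod z) <= 1.

Definition bohr_holds_upto (p N : nat) (rho : R) : Prop :=
  forall (f : C -> C) (a : nat -> C), bounded_analytic_disk f a ->
  forall z : C, Cmod z < 1 -> Cmod z <= rho -> bohr_ineq p N f a z.

Definition best_possible_radius (p N : nat) (rho : R) : Prop :=
  forall rho' : R, rho < rho' -> ~ bohr_holds_upto p N rho'.

Definition the_positive_root (psi : R -> R) (rho : R) : Prop :=
  unique (fun r : R => 0 < r /\ psi r = 0) rho.

(* Main.v *)
Require Import Defs.
From Stdlib Require Import Reals Lra Lia.
From Coquelicot Require Import Coquelicot.
Open Scope R_scope.

(** This is the sharp Bohr-Rogosinski inequality.  Write [alpha] for the modulus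
    of [a 0].  Two classical consequences of [|f| < 1] give the upper bounds: the
    coefficient estimate [|a_k| <= 1 - alpha^2] for [k >= 1] ([coef_bound]), and
    the Schwarz-Pick estimate [|f z| <= (alpha + r) / (1 + alpha r)]
    ([schwarz_pick]).  By the first, the tail of the majorant series is at most
    [(1 - alpha^2) r^N / (1 - r)]; by the second, [1 - |f z|] is at least
    [(1 - alpha)(1 - r) / (1 + alpha r)], and [1 - |f z|^2] is at least
    [(1 - alpha^2)(1 - r^2) / (1 + alpha r)^2].  Comparing, and bounding
    [1 + alpha r] by [1 + r] (and [1 + alpha] by [2] in the first case), the
    inequality holds as soon as [c (1 + r) r^N <= (1 - r)^2], with [c = 2] for
    exponent one and [c = 1] for exponent two.  The Moebius maps
    [(alpha - z) / (1 - alpha z)], evaluated at [z = - r], attain the Schwarz-Pick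
    bound, and their coefficients have modulus [(1 - alpha^2) alpha^(k-1)], so as
    [alpha] tends to [1] nothing is lost and no larger radius works.

    Both classical estimates come from one Hilbert space fact, that on the unit
    circle multiplication by a function bounded by [1] does not increase the
    mean square.  For a polynomial [b] bounded by [1] on the circle it says that
    the map sending [p] to the sequence [sum_m b_m p_(n+m)], which is the adjoint
    of multiplication by [b] up to conjugation, is a contraction
    ([correlation_contraction]).  The proof is finite: means over the circle are
    replaced by means over roots of unity, where Parseval's identity is exact for
    polynomials of small degree ([parseval]).  Testing the contraction on
    sequences supported on [{0, k}] gives the coefficient estimate
    ([poly_coef_bound]); testing it on [w^k + c delta_(k,0)], a combination of the
    reproducing kernels at [w] and at [0], gives the positivity of the two-point
    Pick matrix and hence the Schwarz-Pick estimate ([poly_schwarz_pick]).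

    A function in the disk is reached through the partial sums of
    [rho f(rho z)], [0 < rho < 1]: these converge uniformly on the circle to a
    function bounded by [rho], so they are eventually bounded by [1] there
    ([dilated_partial_sum_bounded]).  Then [rho] tends to [1]. *)

(** * Finite sums *)

(** [sum_n] specialised to complex and real numbers, so that the recursion
    equations are stated with the field operations that [ring] knows. *)
Definition Csum (u : nat -> C) (n : nat) : C := @sum_n C_AbelianMonoid u n.
Definition Rsum (u : nat -> R) (n : nat) : R := @sum_n R_AbelianMonoid u n.

Lemma Csum_0 u : Csum u 0 = u 0%nat.
Proof. apply (@sum_O C_AbelianMonoid). Qed.
Lemma Csum_S u n : Csum u (S n) = (Csum u n + u (S n))%C.
Proof. apply (@sum_Sn C_AbelianMonoid). Qed.
Lemma Rsum_0 u : Rsum u 0 = u 0%nat.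
Proof. apply (@sum_O R_AbelianMonoid). Qed.
Lemma Rsum_S u n : Rsum u (S n) = Rsum u n + u (S n).
Proof. apply (@sum_Sn R_AbelianMonoid). Qed.

Lemma Csum_ext u v n : (forall k, (k <= n)%nat -> u k = v k) -> Csum u n = Csum v n.
Proof. apply (@sum_n_ext_loc C_AbelianMonoid). Qed.
Lemma Rsum_ext u v n : (forall k, (k <= n)%nat -> u k = v k) -> Rsum u n = Rsum v n.
Proof. apply (@sum_n_ext_loc R_AbelianMonoid). Qed.
Lemma Csum_plus u v n : Csum (fun k => u k + v k)%C n = (Csum u n + Csum v n)%C.
Proof. apply (@sum_n_plus C_AbelianMonoid). Qed.
Lemma Rsum_plus u v n : Rsum (fun k => u k + v k) n = Rsum u n + Rsum v n.
Proof. apply (@sum_n_plus R_AbelianMonoid). Qed.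
Lemma Csum_mult_l c u n : Csum (fun k => c * u k)%C n = (c * Csum u n)%C.
Proof. apply (@sum_n_mult_l C_Ring). Qed.
Lemma Rsum_mult_l c u n : Rsum (fun k => c * u k) n = c * Rsum u n.
Proof. apply (@sum_n_mult_l R_Ring). Qed.

Lemma Rsum_le u v n : (forall k, (k <= n)%nat -> u k <= v k) -> Rsum u n <= Rsum v n.
Proof.
  induction n as [|n IH]; intros H; rewrite ?Rsum_0, ?Rsum_S; auto.
  apply Rplus_le_compat; auto.
Qed.

Lemma Rsum_le_extend (u : nat -> R) n d : (forall k, 0 <= u k) -> Rsum u n <= Rsum u (n + d).
Proof.
  intros H; induction d as [|d IH].
  - rewrite Nat.add_0_r; lra.
  - rewrite Nat.add_succ_r, Rsum_S; specialize (H (S (n + d))); lra.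
Qed.

Lemma Rsum_shift_le u K L : (forall k, 0 <= u k) ->
  Rsum (fun n => u (K + n)%nat) L <= Rsum u (K + L).
Proof.
  intros H; induction L as [|L IH].
  - rewrite Rsum_0, Nat.add_0_r.
    destruct K; rewrite ?Rsum_0, ?Rsum_S; try lra.
    assert (0 <= Rsum u K); [|lra].
    clear - H; induction K; rewrite ?Rsum_0, ?Rsum_S; auto.
    specialize (H (S K)); lra.
  - rewrite Nat.add_succ_r, !Rsum_S, Nat.add_succ_r; lra.
Qed.

Lemma Csum_extend (u : nat -> C) n d : (forall k, (n < k)%nat -> u k = 0) ->
  Csum u (n + d) = Csum u n.
Proof.
  intros H; induction d as [|d IH].
  - now rewrite Nat.add_0_r.
  - rewrite Nat.add_succ_r, Csum_S, IH, H by lia; ring.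
Qed.
Lemma Rsum_extend (u : nat -> R) n d : (forall k, (n < k)%nat -> u k = 0) ->
  Rsum u (n + d) = Rsum u n.
Proof.
  intros H; induction d as [|d IH].
  - now rewrite Nat.add_0_r.
  - rewrite Nat.add_succ_r, Rsum_S, IH, H by lia; ring.
Qed.

Lemma Csum_split_first u n : Csum u (S n) = (u 0%nat + Csum (fun k => u (S k)) n)%C.
Proof.
  induction n as [|n IH].
  - now rewrite Csum_S, !Csum_0.
  - rewrite Csum_S, IH, Csum_S; ring.
Qed.

Definition delta (j k : nat) : C := if Nat.eqb j k then 1 else 0.

Lemma delta_refl k : delta k k = 1.
Proof. unfold delta; now rewrite Nat.eqb_refl. Qed.
Lemma delta_neq j k : j <> k -> delta j k = 0.
Proof. unfold delta; intros H; now apply Nat.eqb_neq in H as ->. Qed.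

Lemma Csum_delta (u : nat -> C) k n : (k <= n)%nat -> Csum (fun j => u j * delta j k)%C n = u k.
Proof.
  induction n as [|n IH]; intros H.
  - replace k with 0%nat by lia; rewrite Csum_0, delta_refl; ring.
  - rewrite Csum_S. destruct (Nat.eq_dec k (S n)) as [->|E].
    + rewrite delta_refl, (Csum_ext _ (fun _ => 0 * 0)%C), Csum_mult_l; [ring|].
      intros j Hj; rewrite delta_neq by lia; ring.
    + rewrite IH, delta_neq by lia; ring.
Qed.

(** * Parseval's identity on roots of unity *)

Definition unit_root (M : nat) : C := (cos (2 * PI / INR M), sin (2 * PI / INR M)).

Lemma Cpow_cis t n : (((cos t, sin t) : C) ^ n)%C = (cos (INR n * t), sin (INR n * t)).
Proof.
  induction n as [|n IH].
  - simpl; now rewrite Rmult_0_l, cos_0, sin_0.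
  - rewrite Cpow_S, IH, S_INR.
    replace ((INR n + 1) * t) with (t + INR n * t) by ring.
    rewrite cos_plus, sin_plus; unfold Cmult; simpl; f_equal; ring.
Qed.

Lemma unit_root_pow_M M : (0 < M)%nat -> (unit_root M ^ M)%C = 1.
Proof.
  intros H; unfold unit_root; rewrite Cpow_cis.
  replace (INR M * (2 * PI / INR M)) with (2 * PI) by (field; apply not_0_INR; lia).
  now rewrite cos_2PI, sin_2PI.
Qed.

Lemma unit_root_pow_neq1 M d : (0 < d < M)%nat -> (unit_root M ^ d)%C <> 1.
Proof.
  intros [H1 H2] E; unfold unit_root in E; rewrite Cpow_cis in E.
  injection E as E _.
  apply lt_INR in H1, H2; simpl in H1.
  set (t := INR d * (PI / INR M)) in *.
  replace (INR d * (2 * PI / INR M)) with (2 * t) in E by (unfold t; field; lra).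
  rewrite cos_2a_sin in E.
  assert (0 < t < PI) as [Ht1 Ht2].
  { pose proof PI_RGT_0; unfold t. split.
    - apply Rmult_lt_0_compat; [lra|]. apply Rdiv_lt_0_compat; lra.
    - replace (INR d * (PI / INR M)) with (PI * (INR d / INR M)) by (field; lra).
      rewrite <- (Rmult_1_r PI) at 2. apply Rmult_lt_compat_l; [lra|].
      apply Rlt_div_l; lra. }
  pose proof (sin_gt_0 t Ht1 Ht2). nra.
Qed.

Lemma Cmod_unit_root M : Cmod (unit_root M) = 1.
Proof.
  unfold unit_root, Cmod; simpl.
  rewrite !Rmult_1_r, Rplus_comm.
  fold (Rsqr (cos (2 * PI / INR M))) (Rsqr (sin (2 * PI / INR M))).
  now rewrite sin2_cos2, sqrt_1.
Qed.

Lemma Cgeom x n : (Csum (fun j => x ^ j) n * (x - 1) = x ^ S n - 1)%C.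
Proof.
  induction n as [|n IH].
  - rewrite Csum_0; simpl; ring.
  - rewrite Csum_S, Cmult_plus_distr_r, IH; simpl; ring.
Qed.

Lemma Cconj_unit (z : C) : Cmod z = 1 -> (z * Cconj z)%C = 1.
Proof. intros H; rewrite <- Cmod2_conj, H; f_equal; ring. Qed.

Definition peval (q : nat -> C) (n : nat) (z : C) : C := Csum (fun k => q k * z ^ k)%C n.

(** Orthogonality of two distinct characters of the cyclic group: the terms form
    a geometric progression whose ratio is a root of unity other than [1]. *)
Lemma sum_unit_root_pow_conj T s d : (s < d <= T)%nat ->
  Csum (fun j => (unit_root (S T) ^ j) ^ s * Cconj ((unit_root (S T) ^ j) ^ d))%C T = 0.
Proof.
  intros [H1 H2]; set (w := unit_root (S T)).
  assert (Hw : (w * Cconj w)%C = 1) by (apply Cconj_unit, Cmod_unit_root).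
  set (e := (d - s)%nat).
  rewrite (Csum_ext _ (fun j => (Cconj (w ^ e)) ^ j)%C).
  2:{ intros j _. replace d with (s + e)%nat by (unfold e; lia).
      rewrite Cpow_add_r, Cmult_conj, <- !Cpow_mult_r, Cmult_assoc.
      rewrite Cpow_conj, <- Cpow_mult_l, Hw, Cpow_1_l, Cmult_1_l.
      rewrite Nat.mul_comm, Cpow_mult_r. now rewrite !Cpow_conj. }
  assert (Hn : (w ^ e)%C <> 1) by (apply unit_root_pow_neq1; unfold e; lia).
  assert (E := Cgeom (Cconj (w ^ e)) T).
  rewrite <- Cpow_conj, <- Cpow_mult_r, Nat.mul_comm, Cpow_mult_r in E.
  unfold w in E at 3; rewrite unit_root_pow_M, Cpow_1_l in E by lia.
  destruct (Ceq_dec (Csum (fun j => (Cconj (w ^ e)) ^ j)%C T) 0) as [|N]; [assumption|].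
  exfalso; apply Hn.
  assert (E2 : (Cconj (w ^ e) - 1)%C = 0).
  { destruct (Ceq_dec (Cconj (w ^ e) - 1)%C 0) as [|N2]; [assumption|].
    exfalso; apply (Cmult_neq_0 _ _ N N2). rewrite E.
    unfold Cconj, Cminus, Cplus, Copp, RtoC; simpl; f_equal; ring. }
  rewrite <- (Cconj_conj (w ^ e)).
  replace (Cconj (w ^ e)) with (Cconj (w ^ e) - 1 + 1)%C by ring.
  rewrite E2. unfold Cconj, Cplus, RtoC; simpl; f_equal; ring.
Qed.

Lemma peval_orthogonal_monomial T q s d : (s < d <= T)%nat ->
  Csum (fun j => peval q s (unit_root (S T) ^ j) * Cconj ((unit_root (S T) ^ j) ^ d))%C T = 0.
Proof.
  intros H; induction s as [|s IH]; unfold peval.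
  - rewrite (Csum_ext _ (fun j =>
      q 0%nat * ((unit_root (S T) ^ j) ^ 0 * Cconj ((unit_root (S T) ^ j) ^ d)))%C).
    2:{ intros j _; rewrite Csum_0; ring. }
    rewrite Csum_mult_l, sum_unit_root_pow_conj by lia; ring.
  - rewrite (Csum_ext _ (fun j =>
      peval q s (unit_root (S T) ^ j) * Cconj ((unit_root (S T) ^ j) ^ d)
      + q (S s) * ((unit_root (S T) ^ j) ^ (S s) * Cconj ((unit_root (S T) ^ j) ^ d)))%C).
    2:{ intros j _; rewrite Csum_S; unfold peval; ring. }
    rewrite Csum_plus, Csum_mult_l, sum_unit_root_pow_conj, IH by lia; ring.
Qed.

Lemma Re_Csum u n : Re (Csum u n) = Rsum (fun k => Re (u k)) n.
Proof.
  induction n; rewrite ?Csum_0, ?Rsum_0, ?Csum_S, ?Rsum_S; [easy|].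
  now rewrite <- IHn.
Qed.

Lemma Cmod2_plus x y : Cmod (x + y) ^ 2 = Cmod x ^ 2 + Cmod y ^ 2 + 2 * Re (x * Cconj y).
Proof. rewrite !Cmod2_alt; destruct x, y; simpl; ring. Qed.

(** By induction on the degree: the leading monomial is orthogonal to the rest.
    More points than the degree are needed, or distinct monomials may coincide
    on the sample. *)
Lemma parseval T q s : (s <= T)%nat ->
  Rsum (fun j => Cmod (peval q s (unit_root (S T) ^ j)) ^ 2) T
  = INR (S T) * Rsum (fun k => Cmod (q k) ^ 2) s.
Proof.
  induction s as [|s IH]; intros H.
  - rewrite Rsum_0, (Rsum_ext _ (fun _ => Cmod (q 0%nat) ^ 2)).
    + apply sum_n_const.
    + intros j _; unfold peval; rewrite Csum_0; simpl; now rewrite Cmult_1_r.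
  - rewrite (Rsum_ext _ (fun j => (Cmod (peval q s (unit_root (S T) ^ j)) ^ 2
        + Cmod (q (S s)) ^ 2) +
       2 * Re (Cconj (q (S s)) * (peval q s (unit_root (S T) ^ j)
         * Cconj ((unit_root (S T) ^ j) ^ (S s))))%C)).
    2:{ intros j _; unfold peval; rewrite Csum_S, Cmod2_plus, Cmod_mult.
        rewrite !Cmod_pow, Cmod_unit_root, !pow1, Rmult_1_r.
        do 3 f_equal. rewrite Cmult_conj; ring. }
    rewrite !Rsum_plus, IH, Rsum_mult_l, <- Re_Csum, Csum_mult_l, peval_orthogonal_monomial by lia.
    rewrite Cmult_0_r, Rsum_S; change (Re 0) with 0.
    unfold Rsum at 2; rewrite sum_n_const. ring.
Qed.

(** * The contraction attached to a bounded polynomial *)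

(** On the circle [z^K * b(conj z)] is the polynomial with the coefficients of
    [b] in reverse order, so its product with [p] has [sum_m b_m p_(n+m)] as
    coefficient of [z^(K+n)].  The product is built by Horner's scheme, since
    passing from [K] to [K+1] multiplies the reversed polynomial by [z] and adds
    the constant [b_(K+1)]. *)
Lemma correlation_poly (b p : nat -> C) L K : (forall k, (L < k)%nat -> p k = 0) ->
  exists q : nat -> C,
    (forall n, q (K + n)%nat = Csum (fun m => b m * p (n + m)%nat)%C K) /\
    (forall s, (K + L < s)%nat -> q s = 0) /\
    (forall z, Cmod z = 1 ->
       peval q (K + L) z = (z ^ K * peval b K (Cconj z) * peval p L z)%C).
Proof.
  intros Hp; induction K as [|K [q [H1 [H2 H3]]]].
  - exists (fun s => b 0%nat * p s)%C; repeat split.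
    + intros n; rewrite Csum_0; simpl; now rewrite Nat.add_0_r.
    + intros s Hs; rewrite Hp by lia; ring.
    + intros z _; simpl; unfold peval at 2; rewrite Csum_0; unfold peval.
      rewrite (Csum_ext _ (fun k => b 0%nat * (p k * z ^ k))%C), Csum_mult_l;
        [simpl; ring | intros; ring].
  - exists (fun s => (match s with O => 0 | S s' => q s' end) + b (S K) * p s)%C; repeat split.
    + intros n; rewrite Csum_S, <- H1; replace (n + S K)%nat with (S K + n)%nat by lia; reflexivity.
    + intros s Hs; destruct s as [|s]; [lia|]; rewrite Hp, H2 by lia; ring.
    + intros z Hz.
      assert (E : peval b (S K) (Cconj z) = (peval b K (Cconj z) + b (S K) * Cconj z ^ S K)%C)
        by apply Csum_S.
      rewrite E; clear E.
      transitivity (z * peval q (K + L) z + b (S K) * peval p L z)%C.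
      * unfold peval.
        rewrite (Csum_ext _ (fun s =>
          (match s with O => 0 | S s' => q s' end) * z ^ s + b (S K) * (p s * z ^ s))%C)
          by (intros; ring).
        rewrite Csum_plus, Csum_mult_l; f_equal.
        -- rewrite (Nat.add_succ_l K L), Csum_split_first, Cmult_0_l, Cplus_0_l, <- Csum_mult_l.
           apply Csum_ext; intros; rewrite Cpow_S; ring.
        -- f_equal; rewrite (Nat.add_comm (S K)); apply Csum_extend.
           intros k Hk; rewrite Hp by lia; ring.
      * rewrite H3 by assumption.
        assert (E : (z ^ S K * Cconj z ^ S K)%C = 1)
          by now rewrite <- Cpow_mult_l, Cconj_unit, Cpow_1_l.
        transitivity (z * z ^ K * peval b K (Cconj z) * peval p L z
          + b (S K) * (z ^ S K * Cconj z ^ S K) * peval p L z)%C.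
        -- rewrite E; ring.
        -- rewrite Cpow_S; ring.
Qed.

(** Parseval for [p] and for the product of the previous lemma: pointwise on the
    circle the product is no larger than [p], and the correlations are some of
    its coefficients. *)
Lemma correlation_contraction (b : nat -> C) K (p : nat -> C) L :
  (forall z, Cmod z = 1 -> Cmod (peval b K z) <= 1) ->
  (forall k, (L < k)%nat -> p k = 0) ->
  Rsum (fun n => Cmod (Csum (fun m => b m * p (n + m)%nat)%C K) ^ 2) L
  <= Rsum (fun k => Cmod (p k) ^ 2) L.
Proof.
  intros Hb Hp.
  destruct (correlation_poly b p L K Hp) as [q [H1 [_ H3]]].
  rewrite (Rsum_ext _ (fun n => Cmod (q (K + n)%nat) ^ 2)) by (intros; now rewrite H1).
  eapply Rle_trans; [apply (Rsum_shift_le (fun s => Cmod (q s) ^ 2)); intros; apply pow2_ge_0|].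
  apply (Rmult_le_reg_l (INR (S (K + L)))); [apply lt_0_INR; lia|].
  rewrite <- !parseval by lia.
  apply Rsum_le; intros j _.
  assert (Hz : Cmod (unit_root (S (K + L)) ^ j) = 1)
    by now rewrite Cmod_pow, Cmod_unit_root, pow1.
  rewrite H3, !Cmod_mult, Cmod_pow, Hz, pow1, Rmult_1_l by assumption.
  assert (Cmod (peval b K (Cconj (unit_root (S (K + L)) ^ j))) <= 1)
    by (apply Hb; now rewrite Cmod_conj).
  apply pow_incr; split; [apply Rmult_le_pos; apply Cmod_ge_0|].
  rewrite <- (Rmult_1_l (Cmod (peval p _ _))) at 2.
  apply Rmult_le_compat_r; [apply Cmod_ge_0 | assumption].
Qed.

(** * Coefficient and Schwarz-Pick estimates for polynomials *)

(** The contraction is tested on a sequence supported on [{0, k}], that is on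
    the two by two triangular matrix with [b_0] on the diagonal and [b_k] off
    it. *)
Lemma poly_coef_bound (b : nat -> C) K k :
  (forall z, Cmod z = 1 -> Cmod (peval b K z) <= 1) ->
  (1 <= k <= K)%nat -> Cmod (b 0%nat) < 1 -> Cmod (b k) <= 1 - Cmod (b 0%nat) ^ 2.
Proof.
  intros Hb Hk H0.
  set (a := Cmod (b 0%nat)) in *.
  (* With this pair the entry [b_0 u + b_k v] collapses to [b_k]; it is the
     extremal vector of the resulting quadratic inequality. *)
  set (u := (Cconj (b 0%nat) * b k)%C).
  set (v := RtoC (1 - a ^ 2)).
  assert (Ha : 0 <= a) by apply Cmod_ge_0.
  pose proof (Cmod_ge_0 (b k)) as Hbk.
  set (p := fun j => (u * delta j 0 + v * delta j k)%C).
  assert (Hc := correlation_contraction b K p k Hb).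
  assert (Hsum : forall w : nat -> R, (forall j, 0 <= w j) -> w 0%nat + w k <= Rsum w k).
  { intros w Hw. destruct k as [|k]; [lia|]. rewrite Rsum_S.
    pose proof (Rsum_le_extend w 0 k Hw) as E; rewrite Rsum_0 in E; simpl in E; lra. }
  assert (Hp : Rsum (fun j => Cmod (p j) ^ 2) k = Cmod u ^ 2 + Cmod v ^ 2).
  { destruct k as [|k]; [lia|]. rewrite Rsum_S.
    rewrite (Rsum_ext _ (fun j => Cmod u ^ 2 * Cmod (delta j 0) ^ 2)).
    2:{ intros j Hj; unfold p. rewrite (delta_neq j (S k)) by lia.
        rewrite Cmult_0_r, Cplus_0_r, Cmod_mult; ring. }
    rewrite (Rsum_extend _ 0 k), Rsum_0, delta_refl, Cmod_1.
    - unfold p; rewrite delta_refl, delta_neq, Cmult_0_r, Cplus_0_l, Cmult_1_r by lia; ring.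
    - intros j Hj; rewrite delta_neq, Cmod_0 by lia; ring. }
  rewrite Hp in Hc.
  specialize (Hc ltac:(intros j Hj; unfold p; rewrite !delta_neq by lia; ring)).
  eapply Rle_trans in Hc; [|apply Hsum; intros; apply pow2_ge_0].
  assert (E0 : Csum (fun m => b m * p (0 + m)%nat)%C K = b k).
  { rewrite (Csum_ext _ (fun m => u * (b m * delta m 0) + v * (b m * delta m k))%C)
      by (intros; unfold p; simpl; ring).
    rewrite Csum_plus, !Csum_mult_l, !Csum_delta by lia.
    unfold u, v, a. rewrite RtoC_minus, RtoC_pow, <- RtoC_pow, Cmod2_conj. ring. }
  assert (Ek : Csum (fun m => b m * p (k + m)%nat)%C K = (b 0%nat * v)%C).
  { rewrite (Csum_ext _ (fun m => v * (b m * delta m 0))%C).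
    - rewrite Csum_mult_l, Csum_delta by lia; ring.
    - intros j _; unfold p; rewrite (delta_neq (k + j) 0) by lia.
      destruct j as [|j].
      + rewrite Nat.add_0_r, !delta_refl; ring.
      + rewrite !delta_neq by lia; ring. }
  cbv beta in Hc; rewrite E0, Ek in Hc.
  unfold u, v in Hc; rewrite !Cmod_mult, Cmod_conj, Cmod_R in Hc.
  fold a in Hc. set (c := Cmod (b k)) in *.
  rewrite Rabs_pos_eq in Hc by nra.
  assert (Hd : 0 < 1 - a ^ 2) by nra.
  set (d := 1 - a ^ 2) in *.
  assert (c ^ 2 <= d ^ 2).
  { apply (Rmult_le_reg_l d); [assumption|]. unfold d in *; nra. }
  nra.
Qed.

Lemma Cmod2_sub_mult_add (P c b0 : C) :
  Cmod (P + c * b0) ^ 2 - Cmod P ^ 2 - Cmod (1 + c) ^ 2 + 1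
  = - (2 * Re (c * (1 - Cconj P * b0))) - Cmod c ^ 2 * (1 - Cmod b0 ^ 2).
Proof. rewrite !Cmod2_alt; destruct P, c, b0; simpl; ring. Qed.

(** The contraction tested on [w^k + c delta_(k,0)].  The powers of [w] are nearly
    an eigenvector with eigenvalue [b(w)]: cutting the sequence at [K + T] keeps
    the eigenvalue equation exact at the indices [n <= T]. *)
Lemma pick_kernel (b : nat -> C) K w c T :
  (forall z, Cmod z = 1 -> Cmod (peval b K z) <= 1) ->
  Cmod w < 1 ->
  let P := peval b K w in
  let x := Cmod w ^ 2 in
  Cmod P ^ 2 * (1 - x ^ S T) / (1 - x) + Cmod (P + c * b 0%nat) ^ 2 - Cmod P ^ 2
  <= 1 / (1 - x) + Cmod (1 + c) ^ 2 - 1.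
Proof.
  intros Hb Hw P x.
  pose proof (Cmod_ge_0 w) as Hw0.
  assert (Hx : 0 <= x < 1) by (unfold x; nra).
  set (L := (K + T)%nat).
  set (p := fun k => if (k <=? L)%nat then (w ^ k + c * delta k 0)%C else 0 : C).
  assert (HpL : forall k, (k <= L)%nat -> p k = (w ^ k + c * delta k 0)%C).
  { intros k Hk; unfold p; apply Nat.leb_le in Hk; now rewrite Hk. }
  assert (Hc := correlation_contraction b K p L Hb).
  specialize (Hc ltac:(intros k Hk; unfold p; apply Nat.leb_gt in Hk; now rewrite Hk)).
  assert (Hgeo : forall n, Rsum (fun k => x ^ k) n = (1 - x ^ S n) / (1 - x)).
  { intros n; unfold Rsum; rewrite sum_n_Reals. apply tech3; lra. }
  assert (Hfirst : forall (g : C -> R) n, g 0 = 0 ->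
     Rsum (fun k => g (delta k 0)) n = g 1).
  { intros g n Hg. rewrite (Rsum_extend _ 0 n), Rsum_0.
    - now rewrite delta_refl.
    - intros k Hk; now rewrite delta_neq by lia. }
  assert (Hr : Rsum (fun k => Cmod (p k) ^ 2) L = (1 - x ^ S L) / (1 - x) + (Cmod (1 + c) ^ 2 - 1)).
  { rewrite <- Hgeo.
    replace (Cmod (1 + c) ^ 2 - 1) with (Rsum (fun k => Cmod (delta k 0) * (Cmod (1 + c) ^ 2 - 1)) L)
      by (rewrite (Hfirst (fun d => Cmod d * (Cmod (1 + c) ^ 2 - 1))); rewrite ?Cmod_0, ?Cmod_1; ring).
    rewrite <- Rsum_plus. apply Rsum_ext; intros k Hk.
    rewrite HpL by assumption. destruct k as [|k].
    - rewrite delta_refl, Cmult_1_r, Cmod_1; simpl; ring.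
    - rewrite delta_neq, Cmod_0, Cmult_0_r, Cplus_0_r, Cmod_pow by lia.
      unfold x; rewrite <- !pow_mult, (Nat.mul_comm 2); ring. }
  assert (Hl : Rsum (fun n => Cmod (Csum (fun m => b m * p (n + m)%nat)%C K) ^ 2) T
     = Cmod P ^ 2 * ((1 - x ^ S T) / (1 - x)) + (Cmod (P + c * b 0%nat) ^ 2 - Cmod P ^ 2)).
  { rewrite <- Hgeo, <- Rsum_mult_l.
    replace (Cmod (P + c * b 0%nat) ^ 2 - Cmod P ^ 2)
      with (Rsum (fun k => Cmod (delta k 0) * (Cmod (P + c * b 0%nat) ^ 2 - Cmod P ^ 2)) T)
      by (rewrite (Hfirst (fun d => Cmod d * (Cmod (P + c * b 0%nat) ^ 2 - Cmod P ^ 2)));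
          rewrite ?Cmod_0, ?Cmod_1; ring).
    rewrite <- Rsum_plus. apply Rsum_ext; intros n Hn.
    assert (En : Csum (fun m => b m * p (n + m)%nat)%C K = (w ^ n * P + c * delta n 0 * b 0%nat)%C).
    { rewrite (Csum_ext _ (fun m => w ^ n * (b m * w ^ m) + c * delta n 0 * (b m * delta m 0))%C).
      - rewrite Csum_plus, !Csum_mult_l, Csum_delta by lia; reflexivity.
      - intros m Hm; rewrite HpL, Cpow_add_r by (unfold L; lia).
        destruct n as [|n]; [|now rewrite (delta_neq (S n + m)), (delta_neq (S n)) by lia; ring].
        rewrite delta_refl; simpl; ring. }
    rewrite En. destruct n as [|n].
    - rewrite delta_refl, Cmod_1, Cmult_1_r, Cmult_1_l; simpl; ring.
    - rewrite delta_neq, Cmod_0, Cmult_0_r, Cmult_0_l, Cplus_0_r, Cmod_mult, Cmod_pow by lia.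
      unfold x; rewrite <- !pow_mult, (Nat.mul_comm 2), pow_mult, Rpow_mult_distr; ring. }
  assert (Hle : (1 - x ^ S L) / (1 - x) <= 1 / (1 - x)).
  { apply Rmult_le_compat_r; [left; apply Rinv_0_lt_compat; lra|].
    pose proof (pow_le x (S L) (proj1 Hx)); lra. }
  assert (Hext := Rsum_le_extend (fun n => Cmod (Csum (fun m => b m * p (n + m)%nat)%C K) ^ 2) T K
     ltac:(intros; apply pow2_ge_0)).
  rewrite (Nat.add_comm T K) in Hext. fold L in Hext.
  unfold Rdiv in *; lra.
Qed.

Lemma le_of_geom_slack A B x : 0 <= x < 1 -> 0 <= B ->
  (forall T, A - B * x ^ S T <= 0) -> A <= 0.
Proof.
  intros Hx HB H.
  apply Rnot_lt_le; intros HA.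
  destruct (pow_lt_1_zero x) with (y := A / (B + 1)) as [n Hn].
  - rewrite Rabs_pos_eq; lra.
  - apply Rdiv_lt_0_compat; lra.
  - specialize (Hn (S n) ltac:(lia)). specialize (H n).
    rewrite Rabs_pos_eq in Hn by now apply pow_le.
    apply Rlt_div_r in Hn; [|lra].
    pose proof (pow_le x (S n) (proj1 Hx)). nra.
Qed.

(** Optimising [pick_kernel] over [c], after [T] tends to infinity, gives
    [|1 - conj P b_0|^2 (1 - |w|^2) <= (1 - |P|^2)(1 - |b_0|^2)] with [P = b(w)],
    the nonnegativity of the determinant of the Pick matrix at [0] and [w].  Replacing
    [|1 - conj P b_0|] by [1 - |P| |b_0|] and using
    [(1 - s^2)(1 - a^2) = (1 - s a)^2 - (s - a)^2] leaves
    [|s - a| <= |w| (1 - s a)]. *)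
Lemma poly_schwarz_pick (b : nat -> C) K w :
  (forall z, Cmod z = 1 -> Cmod (peval b K z) <= 1) ->
  Cmod w < 1 -> Cmod (b 0%nat) < 1 ->
  Cmod (peval b K w) * (1 + Cmod (b 0%nat) * Cmod w) <= Cmod (b 0%nat) + Cmod w.
Proof.
  intros Hb Hw H0.
  pose proof (Cmod_ge_0 w) as Hw0. pose proof (Cmod_ge_0 (b 0%nat)) as Ha0.
  set (P := peval b K w).
  set (y := (1 - Cconj P * b 0%nat)%C).
  set (a := Cmod (b 0%nat)) in *. set (s := Cmod P). set (r := Cmod w) in *.
  assert (Hd : 0 < 1 - a ^ 2) by nra.
  assert (Hs0 : 0 <= s) by apply Cmod_ge_0.
  (* The maximiser of [- 2 Re (c y) - |c|^2 (1 - a^2)]. *)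
  set (c := (- (/ (1 - a ^ 2))%R * Cconj y)%C).
  assert (Hpick : Cmod y ^ 2 / (1 - a ^ 2) <= (1 - s ^ 2) / (1 - r ^ 2)).
  { assert (Ec : Cmod (P + c * b 0%nat) ^ 2 - Cmod P ^ 2 - Cmod (1 + c) ^ 2 + 1
        = Cmod y ^ 2 / (1 - a ^ 2)).
    { rewrite Cmod2_sub_mult_add. fold y a.
      replace (c * y)%C with (RtoC (- (Cmod y ^ 2 / (1 - a ^ 2)))).
      - unfold c; rewrite Cmod_mult, Cmod_conj, Cmod_opp, Cmod_R.
        rewrite Rabs_pos_eq by (left; now apply Rinv_0_lt_compat).
        simpl Re; field; lra.
      - unfold c, Rdiv. rewrite RtoC_opp, RtoC_mult, Cmod2_conj. ring. }
    assert (Hr1 : 0 < 1 - r ^ 2) by nra.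
    assert (E : Cmod y ^ 2 / (1 - a ^ 2) - (1 - s ^ 2) / (1 - r ^ 2) <= 0); [|lra].
    apply (le_of_geom_slack _ (s ^ 2 / (1 - r ^ 2)) (r ^ 2)).
    - nra.
    - apply Rmult_le_pos; [apply pow2_ge_0 | left; now apply Rinv_0_lt_compat].
    - intros T. pose proof (pick_kernel b K w c T Hb Hw) as HT; cbv zeta in HT.
      fold P r s in HT. rewrite <- Ec. fold s. unfold Rdiv in *; lra. }
  assert (Hy : 1 - s * a <= Cmod y).
  { assert (E := Cmod_triangle y (Cconj P * b 0%nat)).
    replace (y + Cconj P * b 0%nat)%C with (RtoC 1) in E by (unfold y; ring).
    rewrite Cmod_1, Cmod_mult, Cmod_conj in E. fold s a in E; lra. }
  pose proof (Cmod_ge_0 y) as Hy0.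
  assert (Hr1 : 0 < 1 - r ^ 2) by nra.
  assert (Hmain : Cmod y ^ 2 * (1 - r ^ 2) <= (1 - s ^ 2) * (1 - a ^ 2)).
  { apply Rle_div_r in Hpick; [|lra]. unfold Rdiv in Hpick.
    apply (Rmult_le_reg_r (/ (1 - a ^ 2))); [now apply Rinv_0_lt_compat|].
    rewrite (Rmult_assoc _ (1 - a ^ 2)), Rinv_r by lra. lra. }
  assert (Hs1 : s <= 1).
  { apply Rnot_lt_le; intros Hs. assert (0 < s ^ 2 - 1) by nra.
    pose proof (pow2_ge_0 (Cmod y)). nra. }
  assert (H1 : 0 <= 1 - s * a) by nra.
  assert (H2 : (1 - s * a) ^ 2 <= Cmod y ^ 2) by (apply pow_incr; lra).
  assert (H3 : (s - a) ^ 2 <= (r * (1 - s * a)) ^ 2) by nra.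
  assert (H4 : s - a <= r * (1 - s * a)).
  { apply Rnot_lt_le; intros Hlt. assert (0 <= r * (1 - s * a)) by nra. nra. }
  lra.
Qed.

(** * Bounded analytic functions as limits of bounded polynomials *)

Lemma pow_n_Cpow (z : C) k : @pow_n C_Ring z k = (z ^ k)%C.
Proof. induction k as [|k IH]; [reflexivity|]. simpl; now rewrite IH. Qed.

Lemma pseries_partial_sum (a : nat -> C) (z : C) n :
  @sum_n C_AbelianMonoid (fun k => @scal C_Ring C_ModuleSpace (@pow_n C_Ring z k) (a k)) n = peval a n z.
Proof.
  apply Csum_ext; intros k _; rewrite pow_n_Cpow. apply Cmult_comm.
Qed.

Lemma is_pseries_Cmod (a : nat -> C) (z l : C) :
  @is_pseries C_AbsRing C_NormedModule a z l <->
  (forall eps, 0 < eps -> exists K0, forall K, (K0 <= K)%nat -> Cmod (peval a K z - l) < eps).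
Proof.
  pose proof (@filterlim_locally_ball_norm C_AbsRing nat C_NormedModule eventually _
    (@sum_n C_AbelianMonoid (fun k => @scal C_Ring C_ModuleSpace (@pow_n C_Ring z k) (a k))) l) as E.
  split.
  - intros H eps He. destruct (proj1 E H (mkposreal eps He)) as [K0 HK].
    exists K0; intros K HKK. rewrite <- pseries_partial_sum. exact (HK K HKK).
  - intros H. apply E; intros eps. destruct (H eps (cond_pos eps)) as [K0 HK].
    exists K0; intros K HKK. specialize (HK K HKK).
    rewrite <- pseries_partial_sum in HK. exact HK.
Qed.

Lemma pseries_terms_bounded (a : nat -> C) (z l : C) :
  @is_pseries C_AbsRing C_NormedModule a z l ->
  exists M, forall k, Cmod (a k) * Cmod z ^ k <= M.
Proof.
  intros H.
  destruct (filterlim_bounded _ (ex_intro _ l H)) as [M HM].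
  assert (HM' : forall n, Cmod (peval a n z) <= M).
  { intros n; rewrite <- pseries_partial_sum. apply (HM n). }
  exists (M + M); intros k; rewrite <- Cmod_pow, <- Cmod_mult.
  destruct k as [|k].
  - pose proof (HM' 0%nat) as E; unfold peval in E; rewrite Csum_0 in E.
    pose proof (Cmod_ge_0 (a 0%nat * z ^ 0)); lra.
  - replace (a (S k) * z ^ S k)%C with (peval a (S k) z + - peval a k z)%C
      by (unfold peval; rewrite Csum_S; ring).
    eapply Rle_trans; [apply Cmod_triangle|]. rewrite Cmod_opp.
    apply Rplus_le_compat; apply HM'.
Qed.

(** Convergence at the larger radius [(1 + rho) / 2] bounds the terms by a
    geometric progression on the circle of radius [rho]. *)
Lemma pseries_uniform (a : nat -> C) (f : C -> C) rho eps :
  (forall z : C, Cmod z < 1 -> @is_pseries C_AbsRing C_NormedModule a z (f z)) ->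
  0 < rho < 1 -> 0 < eps ->
  exists K0, forall K, (K0 <= K)%nat -> forall z : C, Cmod z = rho ->
    Cmod (peval a K z - f z) <= eps.
Proof.
  intros Hf Hrho Heps.
  set (sigma := (1 + rho) / 2).
  assert (Hs : rho < sigma < 1) by (unfold sigma; lra).
  assert (Hss : Cmod sigma = sigma) by (rewrite Cmod_R; apply Rabs_pos_eq; lra).
  destruct (pseries_terms_bounded a sigma (f sigma)) as [M HM]; [apply Hf; lra|].
  rewrite Hss in HM.
  set (q := rho / sigma).
  assert (Hq : 0 < q < 1).
  { unfold q; split; [apply Rdiv_lt_0_compat; lra | apply Rlt_div_l; lra]. }
  assert (Hterm : forall z k, Cmod z = rho -> Cmod (a k * z ^ k) <= M * q ^ k).
  { intros z k Hz. rewrite Cmod_mult, Cmod_pow, Hz.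
    replace rho with (sigma * q) by (unfold q; field; lra).
    rewrite Rpow_mult_distr, <- Rmult_assoc. apply Rmult_le_compat_r; [apply pow_le; lra | apply HM]. }
  assert (HM0 : 0 <= M).
  { specialize (HM 0%nat). pose proof (Cmod_ge_0 (a 0%nat)). simpl in HM; lra. }
  assert (Hdiff : forall z K d, Cmod z = rho ->
     Cmod (peval a (K + d) z - peval a K z) <= M * ((q ^ S K - q ^ S (K + d)) / (1 - q))).
  { intros z K d Hz; induction d as [|d IH].
    - rewrite Nat.add_0_r. replace (peval a K z - peval a K z)%C with (RtoC 0) by ring.
      rewrite Cmod_0; right; field; lra.
    - rewrite Nat.add_succ_r.
      replace (peval a (S (K + d)) z - peval a K z)%C
        with ((peval a (K + d) z - peval a K z) + a (S (K + d)) * z ^ S (K + d))%C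
        by (unfold peval; rewrite Csum_S; ring).
      eapply Rle_trans; [apply Cmod_triangle|].
      eapply Rle_trans; [apply Rplus_le_compat; [apply IH | apply Hterm, Hz]|].
      right; simpl; field; lra. }
  set (B := M / (1 - q)).
  assert (HB : 0 <= B) by (apply Rmult_le_pos; [assumption | left; apply Rinv_0_lt_compat; lra]).
  destruct (pow_lt_1_zero q) with (y := eps / 2 / (B + 1)) as [K0 HK0].
  { rewrite Rabs_pos_eq; lra. }
  { apply Rdiv_lt_0_compat; lra. }
  exists K0; intros K HK z Hz.
  destruct (proj1 (is_pseries_Cmod a z (f z)) (Hf z ltac:(lra)) (eps / 2) ltac:(lra)) as [K1 HK1].
  specialize (HK1 (K + K1)%nat ltac:(lia)).
  assert (E : Cmod (peval a (K + K1) z - peval a K z) <= eps / 2).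
  { eapply Rle_trans; [apply Hdiff, Hz|].
    specialize (HK0 (S K) ltac:(lia)). rewrite Rabs_pos_eq in HK0 by (apply pow_le; lra).
    apply Rlt_div_r in HK0; [|lra].
    assert (0 < q ^ S (K + K1)) by (apply pow_lt; lra).
    assert (0 < q ^ S K) by (apply pow_lt; lra).
    replace (M * ((q ^ S K - q ^ S (K + K1)) / (1 - q))) with (B * (q ^ S K - q ^ S (K + K1)))
      by (unfold B; field; lra).
    nra. }
  replace (peval a K z - f z)%C
    with ((peval a (K + K1) z - f z) + - (peval a (K + K1) z - peval a K z))%C by ring.
  eapply Rle_trans; [apply Cmod_triangle|]. rewrite Cmod_opp. lra.
Qed.

Lemma peval_scale a (rho : R) (z : C) K :
  peval (fun m => rho * (a m * rho ^ m))%C K z = (rho * peval a K (rho * z))%C.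
Proof.
  unfold peval; rewrite <- Csum_mult_l; apply Csum_ext; intros k _.
  rewrite Cpow_mult_l; ring.
Qed.

(** The factor [rho] in front makes room for the error of the partial sums: they
    need only be within [1 / rho - 1] of [f]. *)
Lemma dilated_partial_sum_bounded (a : nat -> C) (f : C -> C) (rho : R) :
  bounded_analytic_disk f a -> 0 < rho < 1 ->
  exists K0, forall K, (K0 <= K)%nat -> forall z, Cmod z = 1 ->
    Cmod (peval (fun m => rho * (a m * rho ^ m))%C K z) <= 1.
Proof.
  intros [_ [Hs Hf]] Hr.
  destruct (pseries_uniform a f rho (/ rho - 1) Hs Hr) as [K0 HK0].
  { apply Rlt_0_minus. rewrite <- Rinv_1 at 1. apply Rinv_lt_contravar; lra. }
  exists K0; intros K HK z Hz.
  rewrite peval_scale, Cmod_mult, Cmod_R, Rabs_pos_eq by lra.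
  assert (Hrz : Cmod (rho * z) = rho) by (rewrite Cmod_mult, Cmod_R, Hz, Rabs_pos_eq; lra).
  specialize (HK0 K HK (rho * z)%C Hrz). specialize (Hf (rho * z)%C ltac:(lra)).
  assert (E : Cmod (peval a K (rho * z)) <= / rho).
  { replace (peval a K (rho * z)) with ((peval a K (rho * z) - f (rho * z)) + f (rho * z))%C by ring.
    eapply Rle_trans; [apply Cmod_triangle|]. lra. }
  apply (Rmult_le_compat_l rho) in E; [|lra]. rewrite Rinv_r in E; lra.
Qed.

Lemma le_at_1_of_le_below (F : R -> R) r0 : continuity_pt F 1 -> r0 < 1 ->
  (forall rho, r0 < rho < 1 -> F rho <= 0) -> F 1 <= 0.
Proof.
  intros HF Hr H. apply Rnot_lt_le; intros H1.
  destruct (HF (F 1) H1) as [d [Hd Hd2]].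
  set (rho := Rmax (1 - d / 2) ((1 + r0) / 2)).
  assert (Hrho : 1 - d / 2 <= rho /\ (1 + r0) / 2 <= rho /\ rho < 1).
  { unfold rho; repeat split; [apply Rmax_l | apply Rmax_r | apply Rmax_lub_lt; lra]. }
  specialize (Hd2 rho). specialize (H rho ltac:(lra)).
  simpl in Hd2; unfold R_dist, D_x, no_cond in Hd2.
  assert (E : Rabs (F rho - F 1) < F 1).
  { apply Hd2; split; [split; [easy | lra]|]. apply Rabs_def1; lra. }
  apply Rabs_def2 in E; lra.
Qed.

Lemma bounded_analytic_0 f a : bounded_analytic_disk f a -> f 0 = a 0%nat.
Proof.
  intros [_ [Hs _]].
  assert (H := proj1 (is_pseries_Cmod a 0 (f 0)) (Hs 0 ltac:(rewrite Cmod_0; lra))).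
  assert (E : forall K, peval a K 0 = a 0%nat).
  { intros K; unfold peval.
    rewrite (Csum_extend _ 0 K), Csum_0; [apply Cmult_1_r|].
    intros [|k] Hk; [lia|]; rewrite Cpow_S; ring. }
  assert (E2 : Cmod (a 0%nat - f 0) <= 0).
  { apply Rnot_lt_le; intros HH. destruct (H _ HH) as [K0 HK]. specialize (HK K0 ltac:(lia)).
    rewrite E in HK; lra. }
  pose proof (Cmod_ge_0 (a 0%nat - f 0)).
  assert (E3 : (a 0%nat - f 0)%C = 0) by (apply Cmod_eq_0; lra).
  replace (f 0) with (a 0%nat - (a 0%nat - f 0))%C by ring; rewrite E3; ring.
Qed.

Lemma bounded_analytic_a0_lt_1 f a : bounded_analytic_disk f a -> Cmod (a 0%nat) < 1.
Proof.
  intros H; rewrite <- (bounded_analytic_0 f a H). apply H; rewrite Cmod_0; lra.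
Qed.

Lemma dilated_coef_mod (a : nat -> C) (rho : R) m : 0 < rho ->
  Cmod (rho * (a m * rho ^ m))%C = rho * (Cmod (a m) * rho ^ m).
Proof.
  intros H; rewrite !Cmod_mult, Cmod_pow, Cmod_R, Rabs_pos_eq; lra.
Qed.

(** * Coefficient and Schwarz-Pick estimates in the disk *)

Lemma coef_bound f a k : bounded_analytic_disk f a -> (1 <= k)%nat ->
  Cmod (a k) <= 1 - Cmod (a 0%nat) ^ 2.
Proof.
  intros H Hk. pose proof (bounded_analytic_a0_lt_1 f a H) as H0.
  pose proof (Cmod_ge_0 (a 0%nat)) as H0'.
  set (F := fun rho => rho * (Cmod (a k) * rho ^ k) - (1 - (rho * Cmod (a 0%nat)) ^ 2)).
  assert (HF : F 1 <= 0).
  { apply (le_at_1_of_le_below F 0); [|lra|].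
    - unfold F; reg.
    - intros rho Hr. destruct (dilated_partial_sum_bounded a f rho H Hr) as [K0 HK].
      pose proof (poly_coef_bound _ (K0 + k) k (HK (K0 + k)%nat ltac:(lia)) ltac:(lia)) as E.
      cbv beta in E; rewrite !dilated_coef_mod in E by lra. simpl (rho ^ 0) in E. rewrite Rmult_1_r in E.
      specialize (E ltac:(nra)). unfold F; lra. }
  unfold F in HF; rewrite pow1 in HF; lra.
Qed.

Lemma schwarz_pick f a z : bounded_analytic_disk f a -> Cmod z < 1 ->
  Cmod (f z) * (1 + Cmod (a 0%nat) * Cmod z) <= Cmod (a 0%nat) + Cmod z.
Proof.
  intros H Hz. pose proof (bounded_analytic_a0_lt_1 f a H) as H0.
  pose proof (Cmod_ge_0 (a 0%nat)) as H0'. pose proof (Cmod_ge_0 z) as Hz'.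
  set (s := Cmod (f z)) in *. set (al := Cmod (a 0%nat)) in *. set (r := Cmod z) in *.
  set (F := fun rho => rho ^ 2 * s * (1 + al * r) - (rho ^ 2 * al + r)).
  assert (HF : F 1 <= 0).
  { apply (le_at_1_of_le_below F r); [|lra|].
    - unfold F; reg.
    - intros rho Hr. destruct (dilated_partial_sum_bounded a f rho H ltac:(lra)) as [K0 HK].
      (* The dilated polynomial at [w] is [rho] times a partial sum of the series
         at [z]. *)
      set (w := (z / rho)%C).
      assert (Hrho0 : RtoC rho <> 0) by (intros E; apply RtoC_inj in E; lra).
      assert (Hw : (rho * w)%C = z) by (unfold w; field; assumption).
      assert (Hwm : Cmod w = r / rho).
      { unfold w; rewrite Cmod_div, Cmod_R, Rabs_pos_eq by (assumption || lra); reflexivity. }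
      assert (Hw1 : Cmod w < 1) by (rewrite Hwm; apply Rlt_div_l; lra).
      assert (Hpart : forall K, (K0 <= K)%nat -> rho ^ 2 * Cmod (peval a K z) * (1 + al * r) <= rho ^ 2 * al + r).
      { intros K HKK. pose proof (poly_schwarz_pick _ K w (HK K HKK) Hw1) as E.
        cbv beta in E; rewrite dilated_coef_mod, peval_scale, Hw, Cmod_mult, Cmod_R, Rabs_pos_eq, Hwm in E by lra.
        fold al in E. simpl (rho ^ 0) in E. rewrite Rmult_1_r in E.
        specialize (E ltac:(nra)).
        apply (Rmult_le_compat_l rho) in E; [|lra].
        replace (rho * (rho * Cmod (peval a K z) * (1 + rho * al * (r / rho))))
          with (rho ^ 2 * Cmod (peval a K z) * (1 + al * r)) in E by (field; lra).
        replace (rho * (rho * al + r / rho)) with (rho ^ 2 * al + r) in E by (field; lra).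
        exact E. }
      unfold F. apply Rnot_lt_le; intros Hlt.
      set (c := rho ^ 2 * (1 + al * r)).
      assert (Hc : 0 < c) by (unfold c; apply Rmult_lt_0_compat; nra).
      destruct H as [_ [Hs _]].
      destruct (proj1 (is_pseries_Cmod a z (f z)) (Hs z Hz)
        ((rho ^ 2 * s * (1 + al * r) - (rho ^ 2 * al + r)) / c)) as [K1 HK1].
      { apply Rdiv_lt_0_compat; lra. }
      specialize (HK1 (K0 + K1)%nat ltac:(lia)). specialize (Hpart (K0 + K1)%nat ltac:(lia)).
      apply Rlt_div_r in HK1; [|assumption].
      assert (E : s <= Cmod (peval a (K0 + K1) z) + Cmod (peval a (K0 + K1) z - f z)).
      { unfold s. replace (f z) with (peval a (K0 + K1) z + - (peval a (K0 + K1) z - f z))%C at 1 by ring.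
        eapply Rle_trans; [apply Cmod_triangle|]. rewrite Cmod_opp; lra. }
      unfold c in *. nra. }
  unfold F in HF; lra.
Qed.

(** * The inequality below the critical radius *)

Lemma tail_term_bounds f a N r k : bounded_analytic_disk f a -> (1 <= N)%nat -> 0 <= r ->
  0 <= tail_term a N r k <= (1 - Cmod (a 0%nat) ^ 2) * r ^ N * r ^ k.
Proof.
  intros H HN Hr; unfold tail_term.
  assert (0 <= r ^ (N + k)) by now apply pow_le.
  split.
  - apply Rmult_le_pos; [apply Cmod_ge_0 | assumption].
  - rewrite Rmult_assoc, <- pow_add. apply Rmult_le_compat_r; [assumption|].
    apply (coef_bound f a); [assumption | lia].
Qed.

Lemma ex_series_tail f a N r : bounded_analytic_disk f a -> (1 <= N)%nat -> 0 <= r < 1 ->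
  ex_series (tail_term a N r).
Proof.
  intros H HN Hr.
  apply (@ex_series_le R_AbsRing R_CompleteNormedModule _ (fun k => (1 - Cmod (a 0%nat) ^ 2) * r ^ N * r ^ k)).
  - intros k. change (Rabs (tail_term a N r k) <= (1 - Cmod (a 0%nat) ^ 2) * r ^ N * r ^ k).
    rewrite Rabs_pos_eq; apply (tail_term_bounds f a); tauto.
  - apply (ex_series_scal_l ((1 - Cmod (a 0%nat) ^ 2) * r ^ N) (fun k => r ^ k)).
    apply ex_series_geom. rewrite Rabs_pos_eq; tauto.
Qed.

Lemma tail_sum_le f a N r : bounded_analytic_disk f a -> (1 <= N)%nat -> 0 <= r < 1 ->
  tail_sum a N r <= (1 - Cmod (a 0%nat) ^ 2) * (r ^ N / (1 - r)).
Proof.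
  intros H HN Hr; unfold tail_sum.
  eapply Rle_trans.
  - apply (Series_le _ (fun k => (1 - Cmod (a 0%nat) ^ 2) * r ^ N * r ^ k)).
    + intros k; apply (tail_term_bounds f a); tauto.
    + apply (ex_series_scal_l ((1 - Cmod (a 0%nat) ^ 2) * r ^ N) (fun k => r ^ k)).
      apply ex_series_geom. rewrite Rabs_pos_eq; tauto.
  - rewrite Series_scal_l, Series_geom by (rewrite Rabs_pos_eq; tauto).
    right; field; lra.
Qed.

Lemma bohr_ineq_1 N f a z : bounded_analytic_disk f a -> (1 <= N)%nat -> Cmod z < 1 ->
  2 * (1 + Cmod z) * Cmod z ^ N <= (1 - Cmod z) ^ 2 -> bohr_ineq 1 N f a z.
Proof.
  intros H HN Hz Hpsi; unfold bohr_ineq.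
  pose proof (Cmod_ge_0 z) as Hz0. pose proof (Cmod_ge_0 (a 0%nat)) as Ha0.
  pose proof (bounded_analytic_a0_lt_1 f a H) as Ha1.
  pose proof (schwarz_pick f a z H Hz) as HS.
  pose proof (tail_sum_le f a N (Cmod z) H HN (conj Hz0 Hz)) as HT.
  set (s := Cmod (f z)) in *. set (r := Cmod z) in *. set (al := Cmod (a 0%nat)) in *.
  set (t := r ^ N) in *.
  assert (Hd : 0 < 1 + al * r) by nra.
  assert (E1 : s <= (al + r) / (1 + al * r)) by (apply Rle_div_r; lra).
  assert (E2 : t / (1 - r) <= (1 - r) / (2 * (1 + r))).
  { apply Rle_div_l; [lra|].
    replace ((1 - r) / (2 * (1 + r)) * (1 - r)) with ((1 - r) ^ 2 / (2 * (1 + r))) by (field; lra).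
    apply Rle_div_r; lra. }
  assert (E3 : (1 - al ^ 2) * ((1 - r) / (2 * (1 + r))) <= (1 - al) * (1 - r) / (1 + al * r)).
  { apply -> Rle_div_r; [|assumption].
    replace ((1 - al ^ 2) * ((1 - r) / (2 * (1 + r))) * (1 + al * r))
      with ((1 - al) * (1 - r) * (((1 + al) * (1 + al * r)) / (2 * (1 + r)))) by (field; lra).
    rewrite <- (Rmult_1_r ((1 - al) * (1 - r))) at 2.
    apply Rmult_le_compat_l; [nra|]. apply Rle_div_l; nra. }
  assert (E4 : (1 - al ^ 2) * (t / (1 - r)) <= (1 - al ^ 2) * ((1 - r) / (2 * (1 + r))))
    by (apply Rmult_le_compat_l; [nra | assumption]).
  assert (E5 : (1 - al) * (1 - r) / (1 + al * r) = 1 - (al + r) / (1 + al * r)) by (field; lra).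
  rewrite pow_1; lra.
Qed.

Lemma bohr_ineq_2 N f a z : bounded_analytic_disk f a -> (1 <= N)%nat -> Cmod z < 1 ->
  (1 + Cmod z) * Cmod z ^ N <= (1 - Cmod z) ^ 2 -> bohr_ineq 2 N f a z.
Proof.
  intros H HN Hz Hpsi; unfold bohr_ineq.
  pose proof (Cmod_ge_0 z) as Hz0. pose proof (Cmod_ge_0 (a 0%nat)) as Ha0.
  pose proof (bounded_analytic_a0_lt_1 f a H) as Ha1.
  pose proof (schwarz_pick f a z H Hz) as HS.
  pose proof (tail_sum_le f a N (Cmod z) H HN (conj Hz0 Hz)) as HT.
  pose proof (Cmod_ge_0 (f z)) as Hs0.
  set (s := Cmod (f z)) in *. set (r := Cmod z) in *. set (al := Cmod (a 0%nat)) in *.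
  set (t := r ^ N) in *.
  assert (Hd : 0 < 1 + al * r) by nra.
  assert (E1 : s <= (al + r) / (1 + al * r)) by (apply Rle_div_r; lra).
  apply (fun h => pow_incr s _ 2 (conj Hs0 h)) in E1.
  assert (E2 : t / (1 - r) <= (1 - r) / (1 + r)).
  { apply Rle_div_l; [lra|].
    replace ((1 - r) / (1 + r) * (1 - r)) with ((1 - r) ^ 2 / (1 + r)) by (field; lra).
    apply Rle_div_r; lra. }
  assert (E3 : (1 - al ^ 2) * ((1 - r) / (1 + r)) <= (1 - al ^ 2) * (1 - r ^ 2) / (1 + al * r) ^ 2).
  { apply -> Rle_div_r; [|nra].
    replace ((1 - al ^ 2) * ((1 - r) / (1 + r)) * (1 + al * r) ^ 2)
      with ((1 - al ^ 2) * (1 - r ^ 2) * ((1 + al * r) ^ 2 / (1 + r) ^ 2)) by (field; lra).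
    rewrite <- (Rmult_1_r ((1 - al ^ 2) * (1 - r ^ 2))) at 2.
    apply Rmult_le_compat_l; [apply Rmult_le_pos; nra|]. apply Rle_div_l; [nra|].
    rewrite Rmult_1_l; apply pow_incr; nra. }
  assert (E4 : (1 - al ^ 2) * (t / (1 - r)) <= (1 - al ^ 2) * ((1 - r) / (1 + r)))
    by (apply Rmult_le_compat_l; [nra | assumption]).
  assert (E5 : (1 - al ^ 2) * (1 - r ^ 2) / (1 + al * r) ^ 2 = 1 - ((al + r) / (1 + al * r)) ^ 2) by (field; lra).
  lra.
Qed.

(** * The extremal Moebius maps *)

Definition mobius (al : R) (z : C) : C := ((al - z) / (1 - al * z))%C.
Definition mobius_coef (al : R) (k : nat) : C :=
  match k with O => RtoC al | S j => RtoC (- ((1 - al ^ 2) * al ^ j)) end.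

Lemma mobius_denom_neq_0 (al : R) (z : C) : 0 < al < 1 -> Cmod z < 1 -> (1 - al * z)%C <> 0.
Proof.
  intros Ha Hz E.
  assert (E2 : Cmod 1 = Cmod (al * z)) 
    by (f_equal; replace (al * z)%C with (1 - (1 - al * z))%C by ring; rewrite E; ring).
  rewrite Cmod_1, Cmod_mult, Cmod_R, Rabs_pos_eq in E2 by lra.
  pose proof (Cmod_ge_0 z); nra.
Qed.

Lemma mobius_lt_1 (al : R) (z : C) : 0 < al < 1 -> Cmod z < 1 -> Cmod (mobius al z) < 1.
Proof.
  intros Ha Hz. pose proof (mobius_denom_neq_0 al z Ha Hz) as Hd.
  unfold mobius; rewrite Cmod_div by assumption.
  pose proof (proj1 (Cmod_gt_0 _) Hd) as Hp.
  apply Rlt_div_l; [assumption|]. rewrite Rmult_1_l.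
  apply Rnot_le_lt; intros Hle.
  apply (fun h => pow_incr _ _ 2 (conj (Rlt_le _ _ Hp) h)) in Hle.
  assert (E : Cmod (1 - al * z) ^ 2 - Cmod (al - z) ^ 2 = (1 - al ^ 2) * (1 - Cmod z ^ 2))
    by (rewrite !Cmod2_alt; destruct z; simpl; ring).
  pose proof (Cmod_ge_0 z).
  assert (0 < (1 - al ^ 2) * (1 - Cmod z ^ 2)) by (apply Rmult_lt_0_compat; nra).
  lra.
Qed.

(** The series telescopes after multiplication by the denominator. *)
Lemma mobius_partial_sum (al : R) (z : C) n :
  ((1 - al * z) * peval (mobius_coef al) n z
   = al - z + (1 - al ^ 2) * (al ^ n * z ^ S n))%C.
Proof.
  induction n as [|n IH].
  - unfold peval; rewrite Csum_0; simpl; ring.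
  - unfold peval in *; rewrite Csum_S, Cmult_plus_distr_l, IH.
    change (mobius_coef al (S n)) with (RtoC (- ((1 - al ^ 2) * al ^ n))).
    rewrite RtoC_opp, RtoC_mult, RtoC_minus, !RtoC_pow, !Cpow_S. ring.
Qed.

Lemma mobius_is_pseries (al : R) (z : C) : 0 < al < 1 -> Cmod z < 1 ->
  @is_pseries C_AbsRing C_NormedModule (mobius_coef al) z (mobius al z).
Proof.
  intros Ha Hz. pose proof (mobius_denom_neq_0 al z Ha Hz) as Hd.
  pose proof (proj1 (Cmod_gt_0 _) Hd) as Hp.
  pose proof (Cmod_ge_0 z) as Hz0.
  apply is_pseries_Cmod; intros eps He.
  destruct (pow_lt_1_zero al) with (y := eps * Cmod (1 - al * z)) as [K0 HK0].
  { rewrite Rabs_pos_eq; lra. }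
  { apply Rmult_lt_0_compat; assumption. }
  exists K0; intros K HK. specialize (HK0 K HK).
  replace (peval (mobius_coef al) K z - mobius al z)%C
    with ((((1 - al ^ 2) * (al ^ K * z ^ S K)) / (1 - al * z)))%C.
  2:{ replace (peval (mobius_coef al) K z) with (((1 - al * z) * peval (mobius_coef al) K z) / (1 - al * z))%C
        by (field; assumption).
      rewrite mobius_partial_sum; unfold mobius; field; assumption. }
  rewrite Cmod_div by assumption. apply Rlt_div_l; [assumption|].
  rewrite <- !RtoC_pow, <- RtoC_minus, !Cmod_mult, Cmod_pow, !Cmod_R.
  eapply Rle_lt_trans; [|apply HK0].
  assert (Rabs (1 - al ^ 2) <= 1) by (apply Rabs_le; nra).
  assert (Cmod z ^ S K <= 1) by (rewrite <- (pow1 (S K)); apply pow_incr; lra).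
  pose proof (Rabs_pos (1 - al ^ 2)). pose proof (Rabs_pos (al ^ K)).
  pose proof (pow_le _ (S K) Hz0).
  assert (0 <= Rabs (al ^ K) * Cmod z ^ S K) by (apply Rmult_le_pos; assumption).
  nra.
Qed.

(** Straight from the definition of the derivative: the remainder of the
    first-order expansion at [z] is a multiple of [(y - z)^2], divided by
    [(1 - al y)(1 - al z)^2]. *)
Lemma mobius_ex_derive (al : R) (z : C) : 0 < al < 1 -> Cmod z < 1 ->
  @ex_derive C_AbsRing C_NormedModule (mobius al) z.
Proof.
  intros Ha Hz. pose proof (mobius_denom_neq_0 al z Ha Hz) as Hd.
  pose proof (proj1 (Cmod_gt_0 _) Hd) as Hp.
  set (D := (1 - al * z)%C) in *.
  set (l := (- (1 - al ^ 2) / (D * D))%C).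
  exists l. split.
  - apply (@is_linear_scal_l C_AbsRing C_NormedModule l).
  - intros x Hx.
    apply (@is_filter_lim_locally_unique C_AbsRing (AbsRing_NormedModule C_AbsRing)) in Hx; subst x.
    intros eps.
    set (m := Cmod D) in *.
    (* The first bound keeps [|1 - al y|] above [m / 2]; with it, the second one
       makes the quadratic remainder at most [eps * |y - z|]. *)
    set (del := Rmin (m / 2) (eps * m ^ 3 / 2)).
    assert (Hdel : 0 < del).
    { unfold del; apply Rmin_glb_lt; [lra|].
      assert (0 < m ^ 3) by now apply pow_lt.
      pose proof (cond_pos eps). assert (0 < eps * m ^ 3) by now apply Rmult_lt_0_compat. lra. }
    exists (mkposreal del Hdel); intros y Hy.
    change (Cmod (y - z) < del) in Hy.
    change (Cmod ((mobius al y - mobius al z) - (y - z) * l) <= eps * Cmod (y - z)).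
    assert (Hy1 : Cmod (y - z) < m / 2) by (eapply Rlt_le_trans; [apply Hy | apply Rmin_l]).
    assert (Hy2 : Cmod (y - z) < eps * m ^ 3 / 2) by (eapply Rlt_le_trans; [apply Hy | apply Rmin_r]).
    set (E := (1 - al * y)%C).
    assert (HE : m / 2 <= Cmod E).
    { assert (T := Cmod_triangle E (al * (y - z))).
      replace (E + al * (y - z))%C with D in T by (unfold E, D; ring).
      rewrite Cmod_mult, Cmod_R, Rabs_pos_eq in T by lra. fold m in T.
      pose proof (Cmod_ge_0 (y - z)). nra. }
    assert (HE0 : E <> 0) by (apply Cmod_gt_0; lra).
    replace ((mobius al y - mobius al z) - (y - z) * l)%C
      with (- ((1 - al ^ 2) * al) * ((y - z) * (y - z)) / (E * (D * D)))%C
      by (unfold l, mobius; fold E D; unfold E, D in *; field; split; assumption).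
    rewrite Cmod_div by (repeat apply Cmult_neq_0; assumption).
    rewrite <- RtoC_pow, <- RtoC_minus, <- RtoC_mult, !Cmod_mult, Cmod_opp, Cmod_R. fold m.
    apply Rle_div_l; [repeat apply Rmult_lt_0_compat; lra|].
    set (h := Cmod (y - z)) in *.
    assert (Hh : 0 <= h) by apply Cmod_ge_0.
    assert (Hc : Rabs ((1 - al ^ 2) * al) <= 1) by (apply Rabs_le; nra).
    pose proof (Rabs_pos ((1 - al ^ 2) * al)).
    assert (F1 : Rabs ((1 - al ^ 2) * al) * (h * h) <= h * (eps * m ^ 3 / 2)) by nra.
    assert (F2 : eps * h * (m / 2 * (m * m)) <= eps * h * (Cmod E * (m * m))).
    { apply Rmult_le_compat_l.
      - apply Rmult_le_pos; [left; apply cond_pos | assumption].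
      - apply Rmult_le_compat_r; [nra | assumption]. }
    lra.
Qed.

Lemma mobius_bounded_analytic al : 0 < al < 1 ->
  bounded_analytic_disk (mobius al) (mobius_coef al).
Proof.
  intros Ha; repeat split; intros z Hz.
  - now apply mobius_ex_derive.
  - now apply mobius_is_pseries.
  - now apply mobius_lt_1.
Qed.

Lemma mobius_tail_sum al n r : 0 < al < 1 -> 0 <= r < 1 ->
  tail_sum (mobius_coef al) (S n) r = (1 - al ^ 2) * (al ^ n * r ^ S n) / (1 - al * r).
Proof.
  intros Ha Hr; unfold tail_sum.
  rewrite (Series_ext _ (fun k => (1 - al ^ 2) * (al ^ n * r ^ S n) * (al * r) ^ k)).
  - rewrite Series_scal_l, Series_geom by (rewrite Rabs_pos_eq; nra). reflexivity.
  - intros k; unfold tail_term. simpl (S n + k)%nat; simpl mobius_coef.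
    rewrite Cmod_R, Rabs_Ropp, Rabs_pos_eq.
    + rewrite Rpow_mult_distr, !pow_add; simpl; rewrite pow_add; ring.
    + apply Rmult_le_pos; [nra | apply pow_le; lra].
Qed.

Lemma mobius_neg_real al r : 0 < al < 1 -> 0 <= r < 1 ->
  Cmod (mobius al (RtoC (- r))) = (al + r) / (1 + al * r).
Proof.
  intros Ha Hr; unfold mobius.
  rewrite <- RtoC_mult, <- !RtoC_minus, <- RtoC_div by nra.
  rewrite Cmod_R, Rabs_pos_eq.
  - field; nra.
  - left; apply Rdiv_lt_0_compat; nra.
Qed.

(** The inequality for the Moebius map at [- r], cleared of denominators and
    divided by [1 - al], reads [F al <= 0]; at [al = 1] this contradicts the
    sign of [F 1]. *)
Lemma bohr_fails_1 n r : 0 < r < 1 -> 0 < 2 * (1 + r) * r ^ S n - (1 - r) ^ 2 ->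
  ~ bohr_holds_upto 1 (S n) r.
Proof.
  intros Hr Hpsi H.
  set (F := fun al => (1 + al) * (al ^ n * r ^ S n) * (1 + al * r) - (1 - r) * (1 - al * r)).
  assert (HF : F 1 <= 0).
  { apply (le_at_1_of_le_below F 0); [unfold F; reg | lra |].
    intros al Ha.
    assert (Hm : Cmod (RtoC (- r)) = r) by (rewrite Cmod_R, Rabs_Ropp, Rabs_pos_eq; lra).
    specialize (H _ _ (mobius_bounded_analytic al Ha) (RtoC (- r)) ltac:(lra) ltac:(lra)).
    unfold bohr_ineq in H; rewrite Hm, mobius_neg_real, mobius_tail_sum, pow_1 in H by lra.
    unfold F. set (T := al ^ n * r ^ S n) in *.
    assert (H1 : 0 < 1 + al * r) by nra. assert (H2 : 0 < 1 - al * r) by nra.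
    assert (E : (1 + al) * T * (1 + al * r) - (1 - r) * (1 - al * r)
      = (((al + r) / (1 + al * r) + (1 - al ^ 2) * T / (1 - al * r)) - 1)
        * ((1 + al * r) * (1 - al * r) / (1 - al))) by (field; lra).
    rewrite E.
    assert (0 < (1 + al * r) * (1 - al * r) / (1 - al)) by (apply Rdiv_lt_0_compat; nra).
    nra. }
  unfold F in HF; rewrite pow1 in HF; nra.
Qed.

(** As for exponent one, except that the common factor is [1 - al^2] and the
    limit value [F 1] is [(1 + r)] times the function of the hypothesis. *)
Lemma bohr_fails_2 n r : 0 < r < 1 -> 0 < (1 + r) * r ^ S n - (1 - r) ^ 2 ->
  ~ bohr_holds_upto 2 (S n) r.
Proof.
  intros Hr Hpsi H.
  set (F := fun al => (al ^ n * r ^ S n) * (1 + al * r) ^ 2 - (1 - r ^ 2) * (1 - al * r)).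
  assert (HF : F 1 <= 0).
  { apply (le_at_1_of_le_below F 0); [unfold F; reg | lra |].
    intros al Ha.
    assert (Hm : Cmod (RtoC (- r)) = r) by (rewrite Cmod_R, Rabs_Ropp, Rabs_pos_eq; lra).
    specialize (H _ _ (mobius_bounded_analytic al Ha) (RtoC (- r)) ltac:(lra) ltac:(lra)).
    unfold bohr_ineq in H; rewrite Hm, mobius_neg_real, mobius_tail_sum in H by lra.
    unfold F. set (T := al ^ n * r ^ S n) in *.
    assert (H1 : 0 < 1 + al * r) by nra. assert (H2 : 0 < 1 - al * r) by nra.
    assert (E : T * (1 + al * r) ^ 2 - (1 - r ^ 2) * (1 - al * r)
      = ((((al + r) / (1 + al * r)) ^ 2 + (1 - al ^ 2) * T / (1 - al * r)) - 1)
        * ((1 + al * r) ^ 2 * (1 - al * r) / (1 - al ^ 2))) by (field; nra).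
    rewrite E.
    assert (0 < (1 + al * r) ^ 2 * (1 - al * r) / (1 - al ^ 2)).
    { apply Rdiv_lt_0_compat; [|nra]. apply Rmult_lt_0_compat; [now apply pow_lt | assumption]. }
    nra. }
  unfold F in HF; rewrite pow1 in HF; nra.
Qed.

(** * The critical radius and sharpness *)

Definition psi (c : R) (N : nat) (r : R) : R := c * (1 + r) * r ^ N - (1 - r) ^ 2.

(** On [[0, 1]] the function increases strictly; beyond [1] it is positive because
    [(1 + s) s > (1 - s)^2].  So it changes sign only once, which gives both the
    uniqueness of its root and its sign on either side. *)
Lemma psi_pos_of_lt c N r s : 1 <= c -> (1 <= N)%nat -> 0 <= r < s -> 0 <= psi c N r -> 0 < psi c N s.
Proof.
  intros Hc HN Hrs H; unfold psi in *.
  destruct (Rle_lt_dec 1 s) as [Hs|Hs].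
  - assert (s <= s ^ N) by (rewrite <- (pow_1 s) at 1; apply Rle_pow; assumption || lia).
    assert (1 * s <= c * s ^ N) by (apply Rmult_le_compat; lra).
    assert ((1 + s) * (1 * s) <= (1 + s) * (c * s ^ N)) by (apply Rmult_le_compat_l; lra).
    nra.
  - assert (r ^ N <= s ^ N) by (apply pow_incr; lra).
    assert (0 <= r ^ N) by (apply pow_le; lra).
    assert ((1 + r) * r ^ N <= (1 + s) * s ^ N) by (apply Rmult_le_compat; lra).
    assert (c * ((1 + r) * r ^ N) <= c * ((1 + s) * s ^ N)) by (apply Rmult_le_compat_l; lra).
    nra.
Qed.

Lemma psi_root c N : 1 <= c -> (1 <= N)%nat ->
  exists rho, 0 < rho < 1 /\ the_positive_root (psi c N) rho /\
    (forall r, 0 <= r <= rho -> psi c N r <= 0) /\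
    (forall r, rho < r -> 0 < psi c N r).
Proof.
  intros Hc HN.
  assert (H0 : psi c N 0 < 0) by (unfold psi; rewrite pow_i by lia; lra).
  assert (H1 : 0 < psi c N 1) by (unfold psi; rewrite pow1; lra).
  destruct (IVT (psi c N) 0 1) as [rho [Hrho Erho]]; [unfold psi; reg | lra | assumption | assumption |].
  assert (Hp : 0 < rho) by (destruct (Req_dec rho 0) as [->|]; lra).
  assert (Hp1 : rho < 1) by (destruct (Req_dec rho 1) as [->|]; lra).
  assert (Hle : forall r, 0 <= r <= rho -> psi c N r <= 0).
  { intros r Hr; apply Rnot_lt_le; intros HH.
    destruct (Req_dec r rho) as [->|]; [lra|].
    pose proof (psi_pos_of_lt c N r rho Hc HN ltac:(lra) ltac:(lra)); lra. }
  assert (Hgt : forall r, rho < r -> 0 < psi c N r).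
  { intros r Hr; apply (psi_pos_of_lt c N rho r); lra || assumption. }
  exists rho; repeat split; try assumption.
  intros r [Hr Er].
  destruct (Rtotal_order rho r) as [Hlt|[Heq|Hlt]]; [|assumption|].
  - specialize (Hgt r Hlt); lra.
  - pose proof (psi_pos_of_lt c N r rho Hc HN ltac:(lra) ltac:(lra)); lra.
Qed.

(** The critical radius lies below [1], so any larger radius leaves room for a
    failing one inside the disk. *)
Lemma best_possible_of_fails p N c rho : 0 < rho < 1 ->
  (forall r, rho < r -> 0 < psi c N r) ->
  (forall r, 0 < r < 1 -> 0 < psi c N r -> ~ bohr_holds_upto p N r) ->
  best_possible_radius p N rho.
Proof.
  intros Hrho Hpsi Hf rho' Hlt H.
  set (r := Rmin rho' ((1 + rho) / 2)).
  assert (Hr : rho < r /\ r <= rho' /\ r <= (1 + rho) / 2).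
  { unfold r; repeat split; [apply Rmin_glb_lt; lra | apply Rmin_l | apply Rmin_r]. }
  apply (Hf r); [lra | apply Hpsi; lra |].
  intros f a Hfa z Hz Hzr; apply (H f a Hfa z Hz); lra.
Qed.

Theorem theorem1 (N : nat) (hN : (1 <= N)%nat) :
  (forall (f : C -> C) (a : nat -> C), bounded_analytic_disk f a ->
     forall z : C, Cmod z < 1 -> ex_series (tail_term a N (Cmod z))) /\
  (exists RN : R,
     the_positive_root (fun r : R => 2 * (1 + r) * r ^ N - (1 - r) ^ 2) RN /\
     bohr_holds_upto 1 N RN /\
     best_possible_radius 1 N RN) /\
  (exists RN' : R,
     the_positive_root (fun r : R => (1 + r) * r ^ N - (1 - r) ^ 2) RN' /\
     bohr_holds_upto 2 N RN' /\
     best_possible_radius 2 N RN').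
Proof.
  split; [|split].
  - intros f a H z Hz. apply (ex_series_tail f); [assumption | assumption |].
    split; [apply Cmod_ge_0 | assumption].
  - destruct (psi_root 2 N ltac:(lra) hN) as [rho [Hrho [Hroot [Hle Hgt]]]].
    exists rho; split; [exact Hroot | split].
    + intros f a H z Hz Hzr. apply bohr_ineq_1; try assumption.
      specialize (Hle (Cmod z) (conj (Cmod_ge_0 z) Hzr)). unfold psi in Hle; lra.
    + destruct N as [|n]; [lia|].
      apply (best_possible_of_fails 1 (S n) 2); [assumption | assumption |].
      intros r Hr Hp; apply bohr_fails_1; assumption.
  - destruct (psi_root 1 N ltac:(lra) hN) as [rho [Hrho [Hroot [Hle Hgt]]]].
    exists rho; split; [|split].
    + destruct Hroot as [[Hpos Hr0] Hu]; unfold psi in Hr0; split.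
      * split; [assumption | lra].
      * intros r [Hr1 Hr2]; apply Hu; unfold psi; split; [assumption | lra].
    + intros f a H z Hz Hzr. apply bohr_ineq_2; try assumption.
      specialize (Hle (Cmod z) (conj (Cmod_ge_0 z) Hzr)). unfold psi in Hle; lra.
    + destruct N as [|n]; [lia|].
      apply (best_possible_of_fails 2 (S n) 1); [assumption | assumption |].
      intros r Hr Hp; apply bohr_fails_2; [assumption | unfold psi in Hp; lra].
Qed.
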